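(* Let $q$ and $r$ be distinct primes, let $n$ be a positive integer, and let $\beta,\gamma\in\mathbb{N}$. The primitive subgroups of the symmetric group $S_n$ which are in $\mathfrak{A}_q\mathfrak{A}_r$ and of order $q^{\beta}r^{\gamma}$, if there are any, form a single conjugacy class of subgroups of $S_n$.
   Context: $0\in\mathbb{N}$. For distinct primes $q,r$, $\mathfrak{A}_q\mathfrak{A}_r$ is the variety of all groups $G$ having an abelian normal subgroup $N$ of exponent dividing $q$ such that $G/N$ is abelian of exponent dividing $r$. A subgroup of $S_n$ is primitive if it is transitive on the $n$ points and preserves no partition of them other than the partition into singletons and the partition with one block. *)

(* Defs.v *)
From mathcomp Require Import all_boot all_fingroup all_solvable.

Set Implicit Arguments.
Unset Strict Implicit.
Unset Printing Implicit Defensive.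

Import GroupScope.

(* Finite groups in the product variety A_q A_r: N is the abelian normal subgroup
   of exponent dividing q, and G / N is abelian of exponent dividing r. *)
Definition in_AA (q r : nat) (gT : finGroupType) (G : {group gT}) : bool :=
  [exists N : {group gT},
    [&& N <| G, abelian N, exponent N %| q,
        abelian (G / N) & exponent (G / N) %| r]].

(* The subgroups of S_n considered as permutation groups on 'I_n. The library's
   [primitive _, on _ | _] excludes exactly the invariant partitions Q of 'I_n
   with 1 < #|Q| < n, so it allows only the one-block and singleton ones. *)
Definition primitive_AA (q r n b c : nat) : {set {group 'S_n}} :=
  [set G : {group 'S_n} |
    [&& [primitive G, on [set: 'I_n] | 'P],
        in_AA q r G
      & #|G| == (q ^ b * r ^ c)%N]].

(* Main.v *)
(* Let G be primitive in A_q A_r of degree n > 1 and let N be the elementary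
   abelian normal q-subgroup (or N = G if that subgroup is trivial). Then N acts
   regularly, and a point stabiliser H is a complement of N, isomorphic to an
   elementary abelian group and acting faithfully and irreducibly on N; hence H
   is cyclic, trivial or of prime order. Since |N| = n, the isomorphism types of
   N and H are determined by n and |G|. It remains to compare two faithful
   irreducible modules N, N' of cyclic groups <h>, <h'> of prime order s over
   the same prime field. Over the algebraic closure both h and h' have primitive
   s-th roots of unity as eigenvalues, so h and some power h'^i share an
   eigenvalue. An eigenvector pair gives a nonzero intertwiner over the closure,
   hence one over the prime field, which is injective by irreducibility. The
   resulting equivariant isomorphism N -> N' transports through the regular
   actions to a permutation conjugating G to G'. *)
Require Import Defs.
From mathcomp Require Import all_boot all_fingroup all_solvable.
From mathcomp Require Import all_algebra all_field all_character.

Set Implicit Arguments.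
Unset Strict Implicit.
Unset Printing Implicit Defensive.

Import GroupScope.

(** * Linear algebra: irreducible matrices of prime order and their intertwiners *)

Section Intertwining.

Import GRing.Theory.
Local Open Scope ring_scope.

Definition mx_irr (F : fieldType) n (A : 'M[F]_n) :=
  forall U : 'M_n, stablemx U A -> U != 0 -> row_full U.

(** Half of Schur's lemma: the left kernel of [C] is stable under [A], and it is not the whole space
    when [C] is nonzero. *)
Lemma intertwiner_row_free (F : fieldType) m n (A : 'M[F]_m) (B : 'M_n)
    (C : 'M_(m, n)) :
  mx_irr A -> A *m C = C *m B -> C != 0 -> row_free C.
Proof.
move=> irrA AC nzC; rewrite -kermx_eq0; apply: contraR nzC => /(irrA _).
rewrite sub_kermx -mulmxA AC mulmxA mulmx_ker mul0mx eqxx => /(_ isT).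
by rewrite -sub1mx => /sub_kermxP; rewrite mul1mx => ->.
Qed.

(* The equation A *m C = C *m B is linear in C, so solvability does not depend
   on the field. *)
Lemma intertwiner_descent (F K : fieldType) (f : {rmorphism F -> K}) m n
    (A : 'M[F]_m) (B : 'M_n) (C : 'M_(m, n)) :
  C != 0 -> map_mx f A *m C = C *m map_mx f B ->
  exists2 D : 'M_(m, n), D != 0 & A *m D = D *m B.
Proof.
pose S (L : fieldType) (X : 'M[L]_m) (Y : 'M_n) : 'M[L]_(m * n) :=
  lin_mulmx X - lin_mulmxr Y.
have SE (L : fieldType) (X : 'M[L]_m) Y Z :
    (mxvec Z *m S L X Y == 0) = (X *m Z == Z *m Y).
  by rewrite mulmxBr !mul_vec_lin /= -linearB mxvec_eq0 subr_eq0.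
have mapS : map_mx f (S F A B) = S K (map_mx f A) (map_mx f B).
  rewrite map_mxB; congr (_ - _); apply: map_lin_mx => X /=; exact: map_mxM.
move=> nzC /eqP; rewrite -SE -mapS => /eqP SC.
have: kermx (S F A B) != 0.
  rewrite kermx_eq0 -(row_free_map f); apply: contra nzC => /row_free_inj.
  by move/(_ _ (mxvec C) 0) => inj; rewrite -mxvec_eq0 inj ?mul0mx.
case/rowV0Pn => v /sub_kermxP Sv nzv.
exists (vec_mx v); first by rewrite vec_mx_eq0.
by apply/eqP; rewrite -SE vec_mxK Sv.
Qed.

(** The order of [a] divides [s]. It is not [1]: the nonzero matrix [A - 1] commutes with [A], so it
    is invertible by Schur, also over [K]. *)
Lemma eigenvalue_prim_root (F K : fieldType) (f : {rmorphism F -> K}) m s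
    (A : 'M[F]_m.+1) (a : K) :
    prime s -> mx_irr A -> A ^+ s = 1 -> A != 1 -> eigenvalue (map_mx f A) a ->
  s.-primitive_root a.
Proof.
move=> s_pr irrA As1 A1 /eigenvalueP[v vA nzv].
have as1 : a ^+ s = 1.
  have vAk k : v *m map_mx f (A ^+ k) = a ^+ k *: v.
    elim: k => [|k IH]; first by rewrite !expr0 map_mx1 mulmx1 scale1r.
    by rewrite !exprS map_mxM mulmxA vA -scalemxAl IH scalerA.
  apply/eqP; rewrite -subr_eq0; apply: contraNT nzv => nz_a.
  have: (a ^+ s - 1) *: v == 0.
    by rewrite scalerBl scale1r -vAk As1 map_mx1 mulmx1 subrr.
  by rewrite scaler_eq0 (negPf nz_a).
have [d ad sd] := prim_order_exists (prime_gt0 s_pr) as1.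
case/primeP: s_pr => _ /(_ _ sd)/orP[/eqP d1 | /eqP <- //].
move: ad; rewrite d1 => /prim_expr_order; rewrite expr1 => a1.
case/negP: A1; rewrite -subr_eq0; apply: contraT => nzA.
have AC: A *m (A - 1) = (A - 1) *m A by rewrite mulmxBr mulmxBl mulmx1 mul1mx.
have := intertwiner_row_free irrA AC nzA; rewrite -(row_free_map f).
move/row_free_inj=> /(_ _ v 0) inj; case/eqP: nzv; apply: inj.
by rewrite map_mxB map_mx1 mulmxBr vA a1 scale1r mulmx1 subrr mul0mx.
Qed.

Lemma exists_intertwiner (F : countFieldType) m n s (A : 'M[F]_m.+1)
    (B : 'M_n.+1) :
    prime s -> mx_irr A -> A ^+ s = 1 -> A != 1 ->
    mx_irr B -> B ^+ s = 1 -> B != 1 ->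
  exists i, exists2 D : 'M_(m.+1, n.+1), row_free D & A *m D = D *m B ^+ i.
Proof.
move=> s_pr irrA As1 A1 irrB Bs1 B1.
have [K [f _]] := countable_algebraic_closure F.
have ev k (X : 'M[K]_k.+1) : exists a, eigenvalue X a.
  have /closed_rootP[a aP]: size (char_poly X) != 1 by rewrite size_char_poly.
  by exists a; rewrite eigenvalue_root_char.
have [[a Aa] [b Bb]] := (ev m (map_mx f A), ev n (map_mx f B)).
have pa := eigenvalue_prim_root s_pr irrA As1 A1 Aa.
have pb := eigenvalue_prim_root s_pr irrB Bs1 B1 Bb.
have [i ai] := prim_rootP pb (prim_expr_order pa).
have [w wB nzw] := eigenvalueP Bb.
have wBi : w *m map_mx f (B ^+ i) = a *: w.
  rewrite ai; elim: (i : nat) => [|k IH].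
    by rewrite !expr0 map_mx1 mulmx1 scale1r.
  by rewrite !exprS map_mxM mulmxA wB -scalemxAl IH scalerA.
(* [eigenvalue] speaks of row vectors; a determinant, invariant under transposition, supplies a
   column eigenvector. *)
have [u nzu uA] : exists2 u : 'rV_m.+1, u != 0 & map_mx f A *m u^T = a *: u^T.
  have: \det (a%:M - map_mx f A)^T == 0.
    rewrite det_tr; apply/det0P; have [x xA nzx] := eigenvalueP Aa.
    by exists x => //; rewrite mulmxBr xA mul_mx_scalar subrr.
  case/det0P=> u nzu /(congr1 trmx); rewrite trmx_mul trmxK trmx0 mulmxBl.
  by move/subr0_eq; rewrite mul_scalar_mx => uA; exists u.
exists i.
(* A column eigenvector of [A] times a row eigenvector of [B ^+ i], both for [a], is a rank-one
   intertwiner over [K]. *)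
have [||D nzD AD] := @intertwiner_descent _ _ f _ _ A (B ^+ i) (u^T *m w).
- case/rV0Pn: nzu => j uj; case/rV0Pn: nzw => k wk; apply/matrix0Pn.
  by exists j, k; rewrite mxE big_ord1 mxE mulf_neq0.
- by rewrite mulmxA uA -mulmxA wBi -scalemxAl -scalemxAr.
by exists D => //; apply: intertwiner_row_free irrA AD nzD.
Qed.

End Intertwining.

Lemma cycle_repr_mx_irr (F : fieldType) (gT : finGroupType) (H : {group gT})
    n h (rG : mx_representation F H n) :
  H :=: <[h]> -> mx_irreducible rG -> mx_irr (rG h).
Proof.
move=> defH /mx_irrP[_ irrG] U stU nzU; apply: irrG nzU.
apply/mxmoduleP=> x Hx; have /cycleP[k ->]: x \in <[h]> by rewrite -defH.
have Hh : h \in H by rewrite defH cycle_id.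
elim: k => [|k IH]; first by rewrite expg0 repr_mx1 mulmx1.
rewrite expgS repr_mxM ?groupX // mulmxA.
exact: submx_trans (submxMr _ stU) IH.
Qed.

Lemma exists_equivariant_isom (gT rT : finGroupType) (p : nat)
    (N H : {group gT}) (N' H' : {group rT}) :
    p.-abelem N -> p.-abelem N' -> #|N| = #|N'| ->
    minnormal N H -> minnormal N' H' ->
    'C_H(N) = 1 -> 'C_H'(N') = 1 -> #|H| = #|H'| -> #|H| = 1%N \/ prime #|H| ->
  exists2 f : {morphism N >-> rT}, 'injm f /\ f @* N = N' &
    exists h, exists2 h', H :=: <[h]> /\ H' :=: <[h']> &
      {in N, forall x, f (x ^ h) = f x ^ h'}.
Proof.
move=> abN abN' oN minN minN' CHN CHN' oH [H1 | s_pr].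
  have /isogP[f injf imf] : N \isog N'.
    by rewrite (isog_abelem_card N' abN) abN' oN /=.
  exists f => //; exists 1, 1; last by move=> x Nx; rewrite !conjg1.
  by rewrite !cycle1; split; apply: card1_trivg; rewrite -?oH.
have [/andP[ntN nNH] _] := mingroupP minN.
have [/andP[ntN' nNH'] _] := mingroupP minN'.
have s_pr' : prime #|H'| by rewrite -oH.
have [h defH] := cyclicP (prime_cyclic s_pr).
have [h' defH'] := cyclicP (prime_cyclic s_pr').
have [Hh Hh'] : h \in H /\ h' \in H' by rewrite defH defH' !cycle_id.
pose rG := abelem_repr abN ntN nNH; pose rG' := abelem_repr abN' ntN' nNH'.
have irrA : mx_irr (rG h).
  by apply: cycle_repr_mx_irr defH _; apply/abelem_mx_irrP.
have irrA' : mx_irr (rG' h').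
  by apply: cycle_repr_mx_irr defH' _; apply/abelem_mx_irrP.
have nt : h != 1 by rewrite -cycle_eq1 -defH -cardG_gt1 prime_gt1.
have nt' : h' != 1 by rewrite -cycle_eq1 -defH' -cardG_gt1 prime_gt1.
have A1 : rG h != 1%R.
  apply: contra_neq nt => Ah1; apply/set1gP; rewrite -CHN.
  by rewrite -(rker_abelem abN ntN nNH); apply/rkerP.
have A1' : rG' h' != 1%R.
  apply: contra_neq nt' => Ah1; apply/set1gP; rewrite -CHN'.
  by rewrite -(rker_abelem abN' ntN' nNH'); apply/rkerP.
have As : (rG h ^+ #|H| = 1)%R.
  by rewrite -repr_mxX // expg_cardG // repr_mx1.
have As' : (rG' h' ^+ #|H| = 1)%R.
  by rewrite -repr_mxX // oH expg_cardG // repr_mx1.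
have [i [D freeD AD]] := exists_intertwiner s_pr irrA As A1 irrA' As' A1'.
pose f x := rVabelem abN' ntN' (abelem_rV abN ntN x *m D)%R.
have fM : {in N &, {morph f : x y / x * y}}.
  by move=> x y Nx Ny; rewrite /f abelem_rV_M // mulmxDl rVabelemD.
have injf : 'injm (Morphism fM).
  apply/injmP=> x y Nx Ny /rVabelem_inj /(row_free_inj freeD).
  exact: abelem_rV_inj.
have imf : Morphism fM @* N = N'.
  apply/eqP; rewrite eqEcard card_injm // oN leqnn andbT.
  by apply/subsetP=> _ /morphimP[x _ Nx ->]; apply: mem_rVabelem.
have fJ : {in N, forall x, f (x ^ h) = f x ^ (h' ^+ i)}.
  move=> x Nx; rewrite /f (abelem_rV_J abN ntN nNH) // -mulmxA AD mulmxA.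
  by rewrite -repr_mxX // rVabelemJ ?groupX.
exists (Morphism fM) => //; exists h, (h' ^+ i) => //; split=> //.
(* The order of [h' ^+ i] divides a prime; were it [1], injectivity would make [h] centralise [N],
   against [CHN]. *)
apply/eqP; rewrite eq_sym eqEcard cycle_subG groupX //=.
have: #[h' ^+ i] %| #|H'| by rewrite order_dvdG ?groupX.
case/primeP: (s_pr') => _ /[swap] hi /(_ _ hi)/orP[|/eqP<- //].
rewrite order_eq1 => /eqP hi1; case/eqP: nt.
apply/set1gP; rewrite -CHN inE Hh; apply/centP=> x Nx.
apply/commute_sym/commgP/conjg_fixP; move/injmP: injf => injf; apply: injf.
  by have /subsetP/(_ h Hh) nNh := nNH; rewrite memJ_norm.
exact: Nx.
have E := fJ x Nx; rewrite hi1 conjg1 in E; exact: E.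
Qed.

(** * Transport of an equivariant isomorphism through regular actions *)

Section Conjugation.

Variable T : finType.
Implicit Types (G N : {group {perm T}}) (x : T).

(** Elements agreeing at [x] differ by one fixing [x], which lies both in [N] and in its
    complement. *)
Lemma regular_inj G N x :
  N ><| 'C_G[x | 'P] = G -> {in N &, forall m n : {perm T}, m x = n x -> m = n}.
Proof.
move=> /sdprodP[_ defG _ tiN] m n Nm Nn mn; apply/eqP; rewrite eq_mulgV1.
have sNG : N \subset G by rewrite -defG mulG_subl.
rewrite -in_set1 -[[set 1]]tiN !inE (subsetP sNG) ?groupM ?groupV //=.
by rewrite sub1set inE /= apermE permM mn permK.
Qed.

(** [N] and [N'] label the points, starting from [x] and [x']; the conjugator is the relabelling
    that takes [n x] to [f n x']. *)
Lemma conj_of_equivariant G G' N N' x x' (f : {morphism N >-> {perm T}})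
    (h h' : {perm T}) :
    N ><| 'C_G[x | 'P] = G -> N' ><| 'C_G'[x' | 'P] = G' ->
    [transitive N, on setT | 'P] ->
    'injm f -> f @* N = N' ->
    'C_G[x | 'P] = <[h]> -> 'C_G'[x' | 'P] = <[h']> ->
    {in N, forall n, f (n ^ h) = f n ^ h'} ->
  exists s, (G :^ s)%G = G'.
Proof.
move=> sdG sdG' trN injf imf defH defH' fJ.
have regN := regular_inj sdG; have regN' := regular_inj sdG'.
have Nf n : n \in N -> f n \in N' by move=> Nn; rewrite -imf mem_morphim.
have ex_nu t : exists n : {perm T}, (n \in N) && (n x == t).
  have [n Nn ->] := atransP2 trN (in_setT x) (in_setT t).
  by exists n; rewrite Nn eqxx.
pose nu t := xchoose (ex_nu t).
have Nnu t : nu t \in N by case/andP: (xchooseP (ex_nu t)).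
have nux t : nu t x = t by case/andP: (xchooseP (ex_nu t)) => _ /eqP.
pose g t := f (nu t) x'.
have g_inj : injective g.
  move=> t u /regN' e; rewrite -(nux t) -(nux u); congr (aperm x _).
  exact: injmP injf _ _ (Nnu t) (Nnu u) (e (Nf _ (Nnu t)) (Nf _ (Nnu u))).
pose s := perm g_inj.
have sE (n : {perm T}) : n \in N -> s (n x) = f n x'.
  by move=> Nn; rewrite permE /g; congr (f _ _); apply: regN.
have sP (k k' : {perm T}) :
    (forall m, m \in N -> s (k (m x)) = k' (f m x')) -> k ^ s = k'.
  move=> kk'; apply/permP=> y; rewrite -(permKV s y) permJ.
  by move: (s^-1 y) => t; rewrite -(nux t) kk' // sE.
have sN n : n \in N -> n ^ s = f n.
  move=> Nn; apply: sP => m Nm.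
  by rewrite -(permM m n) sE ?groupM // morphM // permM.
have [_ defG nNH _] := sdprodP sdG; have [_ defG' _ _] := sdprodP sdG'.
have hH : h \in 'C_G[x | 'P] by rewrite defH cycle_id.
have hH' : h' \in 'C_G'[x' | 'P] by rewrite defH' cycle_id.
have hx : h x = x by case/setIP: hH => _ /astab1P.
have hx' : h' x' = x' by case/setIP: hH' => _ /astab1P.
(* Since [h] fixes [x], it moves [m x] to [(m ^ h) x]; likewise for [h'] and [x']. *)
have sh : h ^ s = h'.
  apply: sP => m Nm; rewrite -(permM m h) conjgC permM hx sE ?fJ //.
    by rewrite conjgE !permM -{1}hx' permK.
  by rewrite memJ_norm ?(subsetP nNH).
exists s; apply: val_inj; rewrite /= -defG -defG' conjsMg defH defH' -cycleJ.
rewrite sh; congr (_ * _).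
rewrite -imf morphimEdom; apply/setP=> y; apply/idP/imsetP.
  by rewrite mem_conjg => Ny; exists (y ^ s^-1); rewrite // -sN ?conjgKV.
by case=> n Nn ->; rewrite -sN // memJ_conjg.
Qed.

End Conjugation.

(** * Abelian normal subgroups of a primitive group *)

Section PrimitiveAbelianNormal.

Variables (T : finType) (G : {group {perm T}}).
Hypothesis primG : [primitive G, on setT | 'P].
Implicit Types (N : {group {perm T}}) (x : T).

Lemma trans_cent_fix N (g : {perm T}) x :
  [transitive N, on setT | 'P] -> g \in 'C(N) -> g x = x -> g = 1.
Proof.
move=> trN cNg gx; apply/permP=> y.
have [n Nn ->] := atransP2 trN (in_setT x) (in_setT y).
by rewrite /= apermE perm1 -permM -(centP cNg n Nn) permM gx.
Qed.

(** A nontrivial normal subgroup of a primitive group is transitive; an abelian one centralises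
    itself, so its point stabilisers are trivial. *)
Lemma prim_abelian_normal_regular N :
    N <| G -> abelian N -> N :!=: 1 ->
  [transitive N, on setT | 'P] /\ #|N| = #|T|.
Proof.
move=> nNG cNN ntN; have [|trN] := prim_trans_norm primG nNG.
  have := perm_faithful G; rewrite /faithful => faithG /subset_trans/(_ faithG).
  by rewrite subG1 (negPf ntN).
split=> //; have [x _ defT] := imsetP trN; rewrite -cardsT defT card_orbit.
have -> : 'C_N[x | 'P] = 1; last by rewrite indexg1.
apply/trivgP/subsetP=> g /setIP[Ng /astab1P gx]; apply/set1gP.
by apply: trans_cent_fix trN _ gx; apply: subsetP cNN _ Ng.
Qed.

Lemma prim_abelian_normal_sdprod N x :
    N <| G -> abelian N -> N :!=: 1 ->
  [/\ N ><| 'C_G[x | 'P] = G, minnormal N 'C_G[x | 'P]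
    & 'C_('C_G[x | 'P])(N) = 1].
Proof.
move=> nNG cNN ntN; have [trN oN] := prim_abelian_normal_regular nNG cNN ntN.
have [trG _] := andP primG; have [sNG nNG'] := andP nNG.
have nNH : 'C_G[x | 'P] \subset 'N(N) by rewrite subIset ?nNG'.
have defG : 'C_G[x | 'P] * N = G by apply/subgroup_transitiveP: trN.
split.
- rewrite sdprodE -?(normC nNH) //; apply/trivgP/subsetP=> g.
  case/setIP=> Ng /setIP[_ /astab1P gx]; apply/set1gP.
  by apply: trans_cent_fix trN _ gx; apply: subsetP cNN _ Ng.
- apply/mingroupP; split=> [|M /andP[ntM nMH] sMN]; first by rewrite ntN.
  (* [M] is normalised by the stabiliser and by the abelian group [N], hence by [G]; regularity then
     fixes its order. *)
  have nMG : M <| G.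
    rewrite /normal (subset_trans sMN) //= -defG mulG_subG nMH.
    by rewrite cents_norm // (centsS sMN).
  have [_ oM] := prim_abelian_normal_regular nMG (abelianS sMN cNN) ntM.
  by apply/eqP; rewrite eqEcard sMN oN oM leqnn.
- apply/trivgP/subsetP=> g /setIP[/setIP[_ /astab1P gx] cNg]; apply/set1gP.
  exact: trans_cent_fix trN cNg gx.
Qed.

End PrimitiveAbelianNormal.

(** * Primitive groups in the product variety *)

Lemma prim_AA_structure (q r n : nat) (G : {group 'S_n}) (x : 'I_n) :
    prime q -> prime r -> (1 < n)%N ->
    [primitive G, on setT | 'P] -> in_AA q r G ->
  exists N : {group 'S_n}, exists2 p, p.-abelem N &
    [/\ N <| G, N :!=: 1
      & #|'C_G[x | 'P]| = 1%N \/ prime #|'C_G[x | 'P]|].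
Proof.
move=> q_pr r_pr n_gt1 primG /existsP[N /and5P[nNG cNN eN cQ eQ]].
(* If the witness is trivial, [G] is itself elementary abelian for [r] and replaces it. *)
have [N1 | ntN] := eqVneq (N : {set _}) 1.
  have abG : r.-abelem G.
    rewrite abelemE //; have /isogP[f injf imf] := quotient1_isog G.
    rewrite -(injm_abelian injf) // -(exponent_injm injf) // imf -N1.
    by rewrite cQ.
  have ntG : G :!=: 1.
    apply: contraTneq n_gt1 => G1.
    have /andP[/imsetP[y _ defT] _] := primG.
    rewrite -[n]card_ord -cardsT defT card_orbit G1.
    by rewrite (setIidPl (sub1G _)) indexgg.
  have cGG := abelem_abelian abG.
  have [sdG _ _] := prim_abelian_normal_sdprod primG x (normal_refl G) cGG ntG.
  exists G, r => //; have [_ _ _ tiH] := sdprodP sdG.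
  have H1 : 'C_G[x | 'P] = 1 by apply/trivgP; rewrite -tiH subsetI subsetIl /=.
  by split; rewrite // ?normal_refl //; left; rewrite H1 cards1.
exists N, q; first by rewrite abelemE // cNN.
have [sdG minN CHN] := prim_abelian_normal_sdprod primG x nNG cNN ntN.
have isoH := sdprod_isog sdG.
have abN : q.-abelem N by rewrite abelemE // cNN.
have cH : abelian 'C_G[x | 'P] by rewrite (isog_abelian isoH).
have nNH : 'C_G[x | 'P] \subset 'N(N) by have [_ _] := sdprodP sdG.
(* An abelian group with a faithful irreducible representation is cyclic, so its order is its
   exponent, which divides [r]. *)
have cyH : cyclic 'C_G[x | 'P].
  apply: (mx_faithful_irr_abelian_cyclic (rG := abelem_repr abN ntN nNH)) => //.
    by rewrite /mx_faithful rker_abelem CHN.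
  exact/abelem_mx_irrP.
split=> //; move: eQ; rewrite -(exponent_isog isoH) (exponent_cyclic cyH) => oH.
by case/primeP: (r_pr) => _ /(_ _ oH)/orP[/eqP-> | /eqP->]; [left | right].
Qed.

(** * Invariance under conjugation *)

Lemma in_AA_J (q r : nat) (gT : finGroupType) (G : {group gT}) s :
  in_AA q r G -> in_AA q r (G :^ s).
Proof.
case/existsP=> N /and5P[nNG cNN eN cQ eQ]; apply/existsP; exists (N :^ s)%G.
have fG : conjgm G s @* G = G :^ s by rewrite morphim_conj setIid.
have fN : conjgm G s @* N = N :^ s.
  by rewrite morphim_conj (setIidPr (normal_sub nNG)).
have fQ := morphim_quotm [morphism of conjgm G s] nNG G.
rewrite /= normalJ nNG abelianJ cNN exponentJ eN -fG -fN -fQ /=.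
rewrite morphim_abelian //=; exact: dvdn_trans (exponent_morphim _ _) eQ.
Qed.

(** Primitivity means that a point stabiliser is maximal or all of [G]; conjugation carries the
    stabiliser of [x] to that of [s x]. *)
Lemma primitiveJ (T : finType) (G : {group {perm T}}) s :
  [primitive G, on setT | 'P] -> [primitive G :^ s, on setT | 'P].
Proof.
move=> primG; have [trG _] := andP primG; have [x _ defT] := imsetP trG.
have trGs : [transitive G :^ s, on setT | 'P].
  apply/imsetP; exists (s x) => //; apply/setP=> y.
  rewrite !inE; apply/esym/imsetP.
  have [g Gg gx] := atransP2 trG (in_setT x) (in_setT (s^-1 y)).
  exists (g ^ s); first by rewrite memJ_conjg.
  by rewrite /= apermE permJ -[g x]gx permKV.
move: primG; rewrite (trans_prim_astab (in_setT x) trG).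
rewrite (trans_prim_astab (in_setT (s x)) trGs) -(maximal_eqJ _ _ s) conjIg.
by rewrite -astab1_act.
Qed.

Lemma primitive_AAJ (q r n b c : nat) (G : {group 'S_n}) s :
  G \in primitive_AA q r n b c -> (G :^ s)%G \in primitive_AA q r n b c.
Proof.
rewrite !inE => /and3P[primG AA_G oG].
by rewrite primitiveJ // in_AA_J //= cardJg.
Qed.

(** * Conjugacy of any two such groups *)

Lemma primitive_AA_conj (q r n b c : nat) (G G' : {group 'S_n}) :
    prime q -> prime r -> (1 < n)%N ->
    G \in primitive_AA q r n b c -> G' \in primitive_AA q r n b c ->
  exists s, (G :^ s)%G = G'.
Proof.
move=> q_pr r_pr n_gt1; rewrite !inE.
case/and3P=> primG AA_G /eqP oG /and3P[primG' AA_G' /eqP oG'].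
pose x := Ordinal n_gt1.
have [N [p abN [nNG ntN pH]]] :=
  prim_AA_structure x q_pr r_pr n_gt1 primG AA_G.
have [N' [p' abN' [nNG' ntN' _]]] :=
  prim_AA_structure x q_pr r_pr n_gt1 primG' AA_G'.
have [cN cN'] := (abelem_abelian abN, abelem_abelian abN').
have [trN oN] := prim_abelian_normal_regular primG nNG cN ntN.
have [_ oN'] := prim_abelian_normal_regular primG' nNG' cN' ntN'.
have [sdG minN CHN] := prim_abelian_normal_sdprod primG x nNG cN ntN.
have [sdG' minN' CHN'] := prim_abelian_normal_sdprod primG' x nNG' cN' ntN'.
have eqN : #|N| = #|N'| by rewrite oN oN'.
(* The characteristic can be read off the order, so [N] and [N'], both of order [n], share it. *)
have pdivN (P : {group 'S_n}) k : k.-abelem P -> P :!=: 1 -> k = pdiv #|P|.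
  move=> abP ntP; have [k_pr _ [m ->]] := pgroup_pdiv (abelem_pgroup abP) ntP.
  by rewrite pdiv_pfactor.
have eqp : p' = p by rewrite (pdivN _ _ abN ntN) eqN; apply: pdivN.
rewrite {p'}eqp in abN'.
have oH : #|'C_G[x | 'P]| = #|'C_G'[x | 'P]|.
  apply/eqP; rewrite -(eqn_pmul2l (cardG_gt0 N)) (sdprod_card sdG) eqN.
  by rewrite (sdprod_card sdG') oG oG'.
have [f [injf imf] [h [h' [defH defH'] fJ]]] :=
  exists_equivariant_isom abN abN' eqN minN minN' CHN CHN' oH pH.
exact: conj_of_equivariant sdG sdG' trN injf imf defH defH' fJ.
Qed.

Theorem theoremC (q r n b c : nat) (q_pr : prime q) (r_pr : prime r)
    (neq_qr : q != r) (n_gt0 : (0 < n)%N)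
    (nonempty : primitive_AA q r n b c != set0) :
  exists G : {group 'S_n},
    primitive_AA q r n b c = orbit 'JG [set: 'S_n] G.
Proof.
have [G AA_G] := set0Pn _ nonempty; exists G; apply/setP=> G'.
apply/idP/imsetP=> [AA_G' | [s _ ->]]; last exact: primitive_AAJ.
have [n_gt1 | n_le1] := ltnP 1 n.
  by have [s <-] := primitive_AA_conj q_pr r_pr n_gt1 AA_G AA_G'; exists s.
(* In degree at most [1] the symmetric group is trivial, so all its subgroups coincide. *)
have trivial_perm (A : {group 'S_n}) : A :=: 1.
  apply/trivgP/subsetP=> g _; apply/set1gP/permP=> y; apply: val_inj => /=.
  have ord0n (k : 'I_n) : k = 0%N :> nat.
    by apply/eqP; rewrite -leqn0 -ltnS (leq_trans (ltn_ord k)).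
  by rewrite !ord0n.
by exists 1 => //; apply: val_inj; rewrite /= conjsg1 !trivial_perm.
Qed.
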